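(* Let $\mathbf P=(P,\leq,{}',0,1)$ be a bounded poset with an antitone involution ${}'$. Then its Dedekind–MacNeille completion $\mathbf{DM}(\mathbf P)$ is paraorthomodular if and only if $\mathbf P$ is weakly $D$-continuous.
   Context: A bounded poset with an antitone involution is $(P,\leq,{}',0,1)$ where $(P,\leq)$ is a poset with least element $0$ and greatest element $1$, $x''=x$ for all $x$, and $x\leq y$ implies $y'\leq x'$. For $A\subseteq P$: $L(A)$ is the set of lower bounds of $A$ in $P$, $U(A)$ the set of upper bounds, $A'=\{x'\mid x\in A\}$. For $A,B\subseteq P$, $A\leq B$ means $x\leq y$ for all $x\in A$, $y\in B$. $\mathbf{DM}(\mathbf P)=(\{L(A)\mid A\subseteq P\},\subseteq)$ is a complete lattice, equipped with the antitone involution $X^\bot:=L(X')$, with least element $\{0\}$ and greatest element $P$. A bounded lattice with an antitone involution ${}'$ is paraorthomodular if $x\leq y$ and $x'\wedge y=0$ imply $x=y$. $\mathbf P$ is weakly $D$-continuous if for all $B,C\subseteq P$ with $B\leq C$: if $\bigwedge_{\mathbf P}(C\cup B')=0$ (the infimum in $\mathbf P$ exists and is $0$) then $L(C)\leq U(B)$. *)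

(* Defs.v *)
From HB Require Import structures.
From mathcomp Require Import all_boot all_order.
From mathcomp Require Import boolp classical_sets.

Set Implicit Arguments.
Unset Strict Implicit.
Unset Printing Implicit Defensive.

Import Order.TTheory.
Local Open Scope classical_set_scope.
Local Open Scope order_scope.

HB.mixin Record hasAntitoneInvolution d T of Order.POrder d T := {
  ainv : T -> T;
  ainvK : involutive ainv;
  ainv_anti : forall x y : T, x <= y -> ainv y <= ainv x
}.

#[short(type="invPosetType")]
HB.structure Definition InvPoset d :=
  { T of Order.TBPOrder d T & hasAntitoneInvolution d T }.

#[short(type="invLatticeType")]
HB.structure Definition InvLattice d :=
  { T of Order.TBLattice d T & hasAntitoneInvolution d T }.

Definition paraorthomodular d (T : invLatticeType d) : Prop :=
  forall x y : T, x <= y -> ainv x `&` y = \bot -> x = y.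

Definition setle d (P : porderType d) (A B : set P) : Prop :=
  forall x y, A x -> B y -> x <= y.

(* [infimums S \bot] says that the infimum of [S] exists and is [\bot]. *)
Definition weakly_D_continuous d (P : invPosetType d) : Prop :=
  forall B C : set P, setle B C ->
    infimums (C `|` (ainv @` B))%classic \bot -> setle (lbound C) (ubound B).

Section Polarity.
Context d (P : porderType d).
Implicit Types A B X : set P.

Definition polar_closed X : Prop := exists A, X = lbound A.

Lemma lbound_anti A B : A `<=` B -> lbound B `<=` lbound A.
Proof. by move=> AB x xB y /AB; exact: xB. Qed.

Lemma ubound_anti A B : A `<=` B -> ubound B `<=` ubound A.
Proof. by move=> AB x xB y /AB; exact: xB. Qed.

Lemma sub_lbound_ubound A : A `<=` lbound (ubound A).
Proof. by move=> x Ax y; exact. Qed.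

Lemma lbound_ubound_closed X : polar_closed X -> lbound (ubound X) = X.
Proof.
move=> [A ->]; apply/seteqP; split; last exact: sub_lbound_ubound.
by apply: lbound_anti => x Ax y; exact.
Qed.

Lemma lbound_ubound_min A X :
  polar_closed X -> A `<=` X -> lbound (ubound A) `<=` X.
Proof.
move=> /lbound_ubound_closed {2}<- AX.
exact/lbound_anti/ubound_anti.
Qed.

End Polarity.

(* Boolean form, via classical [asbool], so that [DM P] is a [subType] of
   [set P] and inherits its choice structure and inclusion order. *)
Record DM d (P : porderType d) := MkDM {
  dm_set :> set P;
  dm_closed : `[< polar_closed dm_set >]
}.

HB.instance Definition _ d (P : porderType d) := [isSub for @dm_set d P].
HB.instance Definition _ d (P : porderType d) := [Choice of DM P by <:].
HB.instance Definition _ d (P : porderType d) :=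
  Order.SubChoice_isSubPOrder.Build _ _ _ set_display (DM P).

Section DMLattice.
Context d (P : porderType d).
Implicit Types X Y Z : DM P.

Definition dm_lbound (A : set P) : DM P :=
  MkDM (asboolT (ex_intro _ A erefl)).

Lemma dm_eqP X Y : dm_set X = dm_set Y -> X = Y.
Proof. exact: val_inj. Qed.

Lemma dm_closedP X : polar_closed X.
Proof. exact/asboolP/dm_closed. Qed.

Lemma dm_leE X Y : (X <= Y) = `[< (X : set P) `<=` Y >].
Proof. by []. Qed.

Lemma dm_setI_closed X Y : `[< polar_closed ((X : set P) `&` Y)%classic >].
Proof.
apply/asboolP; have [A XA] := dm_closedP X; have [B YB] := dm_closedP Y.
exists (A `|` B)%classic; rewrite XA YB; apply/seteqP; split.
  by move=> x [xA xB] y [/xA|/xB].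
by move=> x xAB; split=> y yAB; apply: xAB; [left|right].
Qed.

Definition dm_meet X Y : DM P := MkDM (dm_setI_closed X Y).

Definition dm_join X Y : DM P :=
  dm_lbound (ubound ((X : set P) `|` Y)%classic).

Lemma dm_meetP X Y Z : (X <= dm_meet Y Z) = (X <= Y) && (X <= Z).
Proof.
rewrite !dm_leE; apply/asboolP/andP => [XYZ|[/asboolP XY /asboolP XZ]].
  by split; apply/asboolP => x /XYZ [].
by move=> x Xx; split; [exact: XY|exact: XZ].
Qed.

Lemma dm_joinP X Y Z : (dm_join X Y <= Z) = (X <= Z) && (Y <= Z).
Proof.
rewrite !dm_leE; apply/asboolP/andP => [XYZ|[/asboolP XZ /asboolP YZ]].
  by split; apply/asboolP => x Xx; apply: XYZ; apply: sub_lbound_ubound;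
    [left|right].
by apply: lbound_ubound_min; [exact: dm_closedP|move=> x [/XZ|/YZ]].
Qed.

HB.instance Definition _ :=
  Order.POrder_MeetJoin_isLattice.Build set_display (DM P) dm_meetP dm_joinP.

Lemma dm_le0x X : dm_lbound setT <= X.
Proof.
rewrite dm_leE; apply/asboolP; have [A ->] := dm_closedP X.
exact: lbound_anti.
Qed.

Lemma dm_lex1 X : X <= dm_lbound set0.
Proof. by rewrite dm_leE; apply/asboolP => x _ y []. Qed.

HB.instance Definition _ :=
  Order.hasBottom.Build set_display (DM P) dm_le0x.
HB.instance Definition _ :=
  Order.hasTop.Build set_display (DM P) dm_lex1.

Lemma dm_meetE X Y : X `&` Y = ((X : set P) `&` Y)%classic :> set P.
Proof. by []. Qed.

Lemma dm_topE : (\top : DM P) = setT :> set P.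
Proof. by apply/seteqP; split=> // x _ y []. Qed.

Lemma dm_complete (F : set (DM P)) :
  infimums F !=set0 /\ supremums F !=set0.
Proof.
split.
  exists (dm_lbound [set y | exists2 X, F X & ubound X y]); split.
    move=> X FX; rewrite dm_leE; apply/asboolP.
    rewrite /= -[A in _ `<=` A](lbound_ubound_closed (dm_closedP X)).
    by apply: lbound_anti => y Xy; exists X.
  move=> Z ZF; rewrite dm_leE; apply/asboolP => z Zz y [X FX]; apply.
  by have := ZF _ FX; rewrite dm_leE => /asboolP; apply.
exists (dm_lbound (ubound [set y | exists2 X, F X & (X : set P) y])); split.
  move=> X FX; rewrite dm_leE; apply/asboolP => x Xx.
  by apply: sub_lbound_ubound; exists X.
move=> Z FZ; rewrite dm_leE; apply/asboolP.
apply: lbound_ubound_min; first exact: dm_closedP.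
by move=> x [X FX]; have := FZ _ FX; rewrite dm_leE => /asboolP; apply.
Qed.

End DMLattice.

Lemma dm_botE d (P : tbPOrderType d) : (\bot : DM P) = [set \bot] :> set P.
Proof.
apply/seteqP; split=> [x xP|x -> y _]; last exact: le0x.
by apply/eqP; rewrite -lex0; exact: xP.
Qed.

Section DMInvolution.
Context d (P : invPosetType d).
Implicit Types X Y : DM P.

Definition dm_perp X : DM P := dm_lbound (ainv @` (X : set P)).

Lemma ainv_image_ubound (A : set P) : ainv @` lbound A = ubound (ainv @` A).
Proof.
apply/seteqP; split=> [_ [x xA <-] _ [y Ay <-]|x xA].
  exact/ainv_anti/xA.
exists (ainv x); last exact: ainvK.
move=> y Ay; rewrite -(ainvK y); apply: ainv_anti; apply: xA.
by exists y.
Qed.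

Lemma dm_perpK : involutive dm_perp.
Proof.
move=> X; apply: dm_eqP; rewrite /= ainv_image_ubound.
rewrite (_ : _ @` _ = dm_set X); last first.
  apply/seteqP; split=> [_ [_ [x Xx <-] <-]|x Xx]; first by rewrite ainvK.
  by exists (ainv x); [exists x|exact: ainvK].
exact/lbound_ubound_closed/dm_closedP.
Qed.

Lemma dm_perp_anti X Y : X <= Y -> dm_perp Y <= dm_perp X.
Proof.
rewrite !dm_leE => /asboolP XY; apply/asboolP/lbound_anti.
exact: image_subset.
Qed.

HB.instance Definition _ :=
  hasAntitoneInvolution.Build set_display (DM P) dm_perpK dm_perp_anti.

End DMInvolution.

(* Main.v *)
Require Import Defs.
From mathcomp Require Import all_boot all_order.
From mathcomp Require Import boolp classical_sets.

(** Every element of the completion is the closure [LU(B)] of some set [B] of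
    points, and also the cone [L(C)] of some set [C].  Writing a pair of
    elements as [X = LU(B)] and [Y = L(C)] turns each ingredient of
    paraorthomodularity into the matching ingredient of weak D-continuity:
    - [X <= Y] means [B <= C];
    - [X^⊥] is [L(B')] ([dm_perp_closure]), so [X^⊥ ∧ Y = L(C ∪ B')], and this
      is the bottom [{0}] exactly when [0] is the infimum of [C ∪ B'];
    - [Y <= X], which given [X <= Y] amounts to [X = Y], means
      [L(C) <= U(B)].
    The two properties are thus the same statement about pairs [(B, C)], resp.
    [(X, Y)].  To pass from [(X, Y)] to sets one may take [B = X] and
    [C = U(Y)]. *)

Set Implicit Arguments.
Unset Strict Implicit.
Unset Printing Implicit Defensive.

Import Order.TTheory.
Local Open Scope classical_set_scope.
Local Open Scope order_scope.

Lemma lboundU d (P : porderType d) (A B : set P) :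
  lbound (A `|` B) = (lbound A `&` lbound B)%classic.
Proof.
apply/seteqP; split=> [x xAB|x [xA xB] y [/xA|/xB]//].
by split=> y Hy; apply: xAB; [left|right].
Qed.

Lemma infimums_botP d (P : tbPOrderType d) (A : set P) :
  infimums A \bot <-> lbound A = [set \bot].
Proof.
split=> [[_ inf0]|A0].
  apply/seteqP; split=> [x xA|_ -> y _]; last exact: le0x.
  by apply/eqP; rewrite -lex0; exact: inf0.
by split=> [y _|y]; [exact: le0x|rewrite A0 => ->].
Qed.

Lemma dm_le_closure_lbound d (P : porderType d) (B C : set P) :
  dm_lbound (ubound B) <= dm_lbound C <-> setle B C.
Proof.
rewrite dm_leE; split=> [/asboolP BC x y Bx Cy|BC].
  exact: (BC x (sub_lbound_ubound Bx) y Cy).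
apply/asboolP/lbound_anti => y Cy x Bx; exact: BC.
Qed.

Lemma dm_le_lbound_closure d (P : porderType d) (B C : set P) :
  dm_lbound C <= dm_lbound (ubound B) <-> setle (lbound C) (ubound B).
Proof.
rewrite dm_leE; split=> [/asboolP CB x y Cx|CB]; first exact: CB.
by apply/asboolP => x Cx y By; exact: CB.
Qed.

Lemma dm_closureE d (P : porderType d) (X : DM P) :
  dm_lbound (ubound X) = X.
Proof. exact/dm_eqP/lbound_ubound_closed/dm_closedP. Qed.

(** A point lies below [B'] iff its involute lies above [B], and the upper
    bounds of [B] are already upper bounds of [LU(B)]; so closing [B] does not
    shrink [L(B')]. *)
Lemma dm_perp_closure d (P : invPosetType d) (B : set P) :
  ainv (dm_lbound (ubound B)) = dm_lbound (ainv @` B).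
Proof.
apply: dm_eqP; apply/seteqP; split=> /= [|z zB _ [x xB <-]].
  exact/lbound_anti/image_subset/sub_lbound_ubound.
rewrite -(ainvK z); apply: ainv_anti; apply: xB => y By.
by rewrite -(ainvK y); apply: ainv_anti; apply: zB; exists y.
Qed.

Lemma dm_meet_perp_eq0 d (P : invPosetType d) (B C : set P) :
  ainv (dm_lbound (ubound B)) `&` dm_lbound C = \bot <->
  infimums (C `|` (ainv @` B))%classic \bot.
Proof.
rewrite dm_perp_closure infimums_botP lboundU setIC -dm_botE.
by split=> [<-|H]; [rewrite dm_meetE|apply: dm_eqP; rewrite dm_meetE].
Qed.

Theorem theorem4p2 (d : Order.disp_t) (P : invPosetType d) :
  paraorthomodular (DM P) <-> weakly_D_continuous P.
Proof.
split=> [pom B C BC /dm_meet_perp_eq0 BC0|wdc X Y XY XY0].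
  apply/dm_le_lbound_closure.
  by rewrite (pom _ _ _ BC0) //; exact/dm_le_closure_lbound.
apply/le_anti/andP; split=> //.
move: XY XY0; rewrite -(dm_closureE X) -(dm_closureE Y).
move=> /dm_le_closure_lbound XY /dm_meet_perp_eq0 XY0.
exact/dm_le_lbound_closure/wdc.
Qed.
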